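(* Let $(B_k,\delta_k)_{k\ge1}$ be any sequence with $B_k\ge 1$, $\delta_k\in(0,1)$ and $B_k+\delta_k^{-1}\to\infty$, and write $L_k=\log(\delta_k^{-1})$ and $d_k=d_{B_k;\delta_k}(e^{x})$. Then: \begin{enumerate} \item If $B_k/L_k\to 0$, then $d_k = \dfrac{L_k}{\log(B_k^{-1}L_k)}\,(1+o(1))$. \item If $B_k = 2rL_k$ for a fixed $r>0$, then $d_k = (\mu r+o(1))L_k$, where $\mu=\mu(r)>0$ is the unique positive solution of $G(\mu)=-1-r^{-1}$. \item If $B_k/L_k\to\infty$, then $d_k=\dfrac{z_*B_k}{2}(1+o(1))$, where $z_*\approx 2.2334$ is the unique positive solution of $G(z_* )=-1$. \end{enumerate}
   Context: For real $B\ge1$, $\delta\in(0,1)$ and a function $f:[0,B]\to\mathbb{R}$, $d_{B;\delta}(f)$ denotes the minimum degree of a non-constant real polynomial $p$ satisfying $\sup_{x\in[0,B]}|p(x)-f(x)|<\delta$. Define $G:\mathbb{R}_{\ge0}\to\mathbb{R}$ by $G(x)=\sqrt{x^2+1}+x\log\big(\sqrt{x^2+1}-x\big)$ (natural logarithm); $G(0)=1$, $G$ is strictly decreasing on $(0,\infty)$ and tends to $-\infty$, so the solutions referred to are unique. All $o(1)$ terms are as $k\to\infty$. *)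

(* Defs.v *)
From Stdlib Require Import Reals List.
From Coquelicot Require Import Coquelicot.
Open Scope R_scope.

(* Polynomial given by its coefficient list [a0; a1; ...; an]
   (lowest degree first), evaluated by Horner's scheme. *)
Definition peval (c : list R) (x : R) : R :=
  fold_right (fun a acc => a + x * acc) 0 c.

Definition poly_deg (c : list R) (n : nat) : Prop :=
  length c = S n /\ last c 0 <> 0.

(* p is a non-constant real polynomial of degree n with
   sup_{x in [0,B]} |p(x) - f(x)| < delta
   (written literally: the sup is bounded by some eps < delta). *)
Definition good_approx (B delta : R) (f : R -> R) (n : nat) : Prop :=
  (1 <= n)%nat /\
  exists c : list R, poly_deg c n /\
    exists eps, eps < delta /\
      forall x, 0 <= x <= B -> Rabs (peval c x - f x) <= eps.

Definition is_min_deg (B delta : R) (f : R -> R) (d : nat) : Prop :=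
  good_approx B delta f d /\
  forall m, good_approx B delta f m -> (d <= m)%nat.

Definition G (x : R) : R :=
  sqrt (x ^ 2 + 1) + x * ln (sqrt (x ^ 2 + 1) - x).

(* Main.v *)
Require Import Defs.
From Stdlib Require Import Reals List Lra Lia ZArith.
From Coquelicot Require Import Coquelicot.
Open Scope R_scope.

(** Put [b = B / 2] and [x = b (1 + t)] with [-1 <= t <= 1], so that
    [exp x = exp b * exp (b t)], and let [N] be the degree.

    Upper bound: the Chebyshev coefficients of [exp (b t)] are nonnegative and
    [cheb j t0 = (rho ^ j + rho ^ -j) / 2] at [t0 = (rho + / rho) / 2]. Hence the part of
    the expansion of index above [N] is at most [2 rho ^ -N exp (b t0)]. With [N = z b]
    the best [rho] is [z + sqrt (z ^ 2 + 1)], and the error is at most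
    [2 exp (b (1 + G z))].

    Lower bound: the alternating mean over the extremal points [cos (k PI / N)] kills
    polynomials of degree below [N], while on [exp x] it is at least
    [exp b (b / 2) ^ (N + 2 i) / (i! (N + i)!)] for every [i]. Choosing the largest such
    term, Stirling's bound gives [exp (b (1 + G z))] up to a power of [b].

    So the minimal degree is [z b] with [G z] close to [-1 - L / b]. When [b / L] tends
    to [0] the choices [rho] of order [L / b] and [i = 0] suffice. *)

(** * Taylor partial sums of the exponential *)

Definition exp_taylor (M : nat) (x : R) : R :=
  sum_f_R0 (fun i => x ^ i / INR (fact i)) M.

Lemma exp_taylor_lim (x : R) : is_lim_seq (fun M => exp_taylor M x) (exp x).
Proof.
  assert (H := is_exp_Reals x). apply is_pseries_R in H.
  apply is_lim_seq_ext with (2 := H). intros M.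
  rewrite sum_n_Reals. unfold exp_taylor. apply sum_eq. intros i _.
  unfold Rdiv. ring.
Qed.

Lemma exp_taylor_le_exp (M : nat) (x : R) : 0 <= x -> exp_taylor M x <= exp x.
Proof.
  intros Hx. apply (is_lim_seq_incr_compare (fun M => exp_taylor M x)).
  - apply exp_taylor_lim.
  - intros n. unfold exp_taylor. rewrite ?tech5.
    enough (0 <= x ^ S n / INR (fact (S n))) by lra.
    apply Rdiv_le_0_compat; [now apply pow_le | apply INR_fact_lt_0].
Qed.

Lemma exp_taylor_diff_le (b x : R) (M k : nat) :
  Rabs x <= b ->
  Rabs (exp_taylor (k + M) x - exp_taylor M x)
    <= exp_taylor (k + M) b - exp_taylor M b.
Proof.
  intros Hx. induction k as [|k IH].
  - simpl. rewrite !Rminus_diag, Rabs_R0. lra.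
  - unfold exp_taylor in *. rewrite Nat.add_succ_l. rewrite !tech5.
    set (u := sum_f_R0 _ (k + M)) in *. set (v := sum_f_R0 _ M) in *.
    set (u' := sum_f_R0 _ (k + M)) in *. set (v' := sum_f_R0 _ M) in *.
    set (m := S (k + M)).
    assert (Rabs (x ^ m / INR (fact m)) <= b ^ m / INR (fact m)).
    { unfold Rdiv. rewrite Rabs_mult, <- RPow_abs.
      rewrite (Rabs_pos_eq (/ _)).
      - apply Rmult_le_compat_r.
        + left. apply Rinv_0_lt_compat, INR_fact_lt_0.
        + apply pow_incr. split; [apply Rabs_pos | exact Hx].
      - left. apply Rinv_0_lt_compat, INR_fact_lt_0. }
    replace (u + x ^ m / INR (fact m) - v) with ((u - v) + x ^ m / INR (fact m)) by ring.
    eapply Rle_trans; [apply Rabs_triang|]. lra.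
Qed.

(** The terms at [x] are dominated by those at [b], so the tail at [b] bounds every tail. The index
    [m] lets the lower bound force a chosen term into the partial sum. *)
Lemma exp_taylor_uniform (b eta : R) (m : nat) :
  0 <= b -> 0 < eta ->
  exists M, (m <= M)%nat /\
    forall x, Rabs x <= b -> Rabs (exp x - exp_taylor M x) <= eta.
Proof.
  intros Hb He.
  destruct (proj2 (is_lim_seq_spec _ _) (exp_taylor_lim b) (mkposreal eta He))
    as [M0 HM0].
  simpl in HM0. set (M := (m + M0)%nat). exists M. split; [unfold M; lia|].
  intros x Hx.
  assert (Hd : exp b - exp_taylor M b <= eta).
  { specialize (HM0 M ltac:(unfold M; lia)). apply Rabs_def2 in HM0. lra. }
  apply Rle_trans with (2 := Hd).
  assert (Hl : is_lim_seq
    (fun k => Rabs (exp_taylor (k + M) x - exp_taylor M x))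
    (Rabs (exp x - exp_taylor M x))).
  { apply (is_lim_seq_abs _ (Finite _)). apply is_lim_seq_minus'.
    - apply (is_lim_seq_incr_n (fun M => exp_taylor M x)), exp_taylor_lim.
    - apply is_lim_seq_const. }
  apply (is_lim_seq_le _ _ (Finite _) (Finite _)) with (2 := Hl) (3 := is_lim_seq_const _).
  intros k. eapply Rle_trans; [exact (exp_taylor_diff_le b x M k Hx)|].
  apply Rplus_le_compat_r, (exp_taylor_le_exp _ b Hb).
Qed.

(** * Chebyshev polynomials *)

(** The polynomials of the first kind; the nested match makes the two-step recursion structural. *)
Fixpoint cheb (n : nat) (t : R) : R :=
  match n with
  | O => 1
  | S p => match p with O => t | S q => 2 * t * cheb p t - cheb q t end
  end.

Lemma cheb_SS (n : nat) (t : R) : cheb (S (S n)) t = 2 * t * cheb (S n) t - cheb n t.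
Proof. reflexivity. Qed.

Lemma nat_two_step_ind (P : nat -> Prop) :
  P 0%nat -> P 1%nat -> (forall n, P n -> P (S n) -> P (S (S n))) -> forall n, P n.
Proof.
  intros H0 H1 HS n. enough (P n /\ P (S n)) by tauto.
  induction n as [|n [IH1 IH2]]; split; auto.
Qed.

Lemma cheb_cos (n : nat) (u : R) : cheb n (cos u) = cos (INR n * u).
Proof.
  induction n as [| |n IH1 IH2] using nat_two_step_ind.
  - simpl. now rewrite Rmult_0_l, cos_0.
  - simpl. now rewrite Rmult_1_l.
  - rewrite cheb_SS, IH1, IH2.
    replace (INR n * u) with (INR (S n) * u - u) by (rewrite S_INR; ring).
    replace (INR (S (S n)) * u) with (INR (S n) * u + u) by (rewrite !S_INR; ring).
    rewrite cos_plus, cos_minus. ring.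
Qed.

Lemma cheb_abs_le_1 (n : nat) (t : R) : -1 <= t <= 1 -> Rabs (cheb n t) <= 1.
Proof.
  intros Ht. rewrite <- (cos_acos t Ht), cheb_cos.
  apply Rabs_le. apply COS_bound.
Qed.

(** Both sides obey the same three-term recurrence. For [rho > 1] the argument lies to the right of
    [[-1, 1]], where growth replaces oscillation. *)
Lemma cheb_joukowski (n : nat) (rho : R) : rho <> 0 ->
  cheb n ((rho + / rho) / 2) = (rho ^ n + / rho ^ n) / 2.
Proof.
  intros Hr. induction n as [| |n IH1 IH2] using nat_two_step_ind.
  - simpl. field.
  - simpl. field. auto.
  - rewrite cheb_SS, IH1, IH2. simpl. field. split; auto. now apply pow_nonzero.
Qed.

(** * Polynomial functions of bounded degree *)

(** The leading coefficient may vanish, so the degree is at most [n]; unlike [poly_deg], this is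
    closed under linear combinations. *)
Definition poly_fun (n : nat) (f : R -> R) : Prop :=
  exists c, length c = S n /\ forall x, peval c x = f x.

Lemma peval_zero (n : nat) : exists c, length c = n /\ forall x, peval c x = 0.
Proof.
  exists (repeat 0 n). split; [apply repeat_length|].
  intros x. induction n as [|n IH]; simpl; [reflexivity|].
  fold (peval (repeat 0 n) x). rewrite IH. ring.
Qed.

Lemma peval_lincomb (u v : R) (c1 c2 : list R) : length c1 = length c2 ->
  exists c, length c = length c1 /\
    forall x, peval c x = u * peval c1 x + v * peval c2 x.
Proof.
  revert c2. induction c1 as [|a1 c1 IH]; intros [|a2 c2] Hl; try discriminate.
  - exists nil. split; [reflexivity|]. intros x; simpl; ring.
  - destruct (IH c2) as [c [Hc Hp]]; [now injection Hl|].
    exists ((u * a1 + v * a2) :: c). split; [simpl; now rewrite Hc|].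
    intros x. simpl. fold (peval c x) (peval c1 x) (peval c2 x).
    rewrite Hp. ring.
Qed.

Lemma poly_fun_ext (n : nat) (f g : R -> R) :
  (forall x, f x = g x) -> poly_fun n f -> poly_fun n g.
Proof.
  intros He [c [Hl Hp]]. exists c. split; auto. intros x. now rewrite Hp.
Qed.

Lemma poly_fun_const (n : nat) (a : R) : poly_fun n (fun _ => a).
Proof.
  destruct (peval_zero n) as [c [Hl Hp]].
  exists (a :: c). split; [simpl; now rewrite Hl|].
  intros x. simpl. fold (peval c x). rewrite Hp. ring.
Qed.

Lemma poly_fun_lincomb (n : nat) (u v : R) (f g : R -> R) :
  poly_fun n f -> poly_fun n g -> poly_fun n (fun x => u * f x + v * g x).
Proof.
  intros [c1 [Hl1 H1]] [c2 [Hl2 H2]].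
  destruct (peval_lincomb u v c1 c2) as [c [Hl Hp]]; [congruence|].
  exists c. split; [congruence|]. intros x. now rewrite Hp, H1, H2.
Qed.

Lemma poly_fun_S (n : nat) (f : R -> R) : poly_fun n f -> poly_fun (S n) f.
Proof.
  intros [c [Hl Hp]]. exists (c ++ 0 :: nil). split.
  - rewrite length_app, Hl. simpl. lia.
  - intros x. rewrite <- Hp. unfold peval. rewrite fold_right_app.
    simpl. f_equal. ring.
Qed.

Lemma poly_fun_le (n m : nat) (f : R -> R) : (n <= m)%nat -> poly_fun n f -> poly_fun m f.
Proof. intros H Hf. induction H; auto. now apply poly_fun_S. Qed.

Lemma poly_fun_mul_affine (n : nat) (u v : R) (f : R -> R) :
  poly_fun n f -> poly_fun (S n) (fun x => (u * x + v) * f x).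
Proof.
  intros Hf.
  assert (Hx : poly_fun (S n) (fun x => x * f x)).
  { destruct Hf as [c [Hl Hp]]. exists (0 :: c). split; [simpl; now rewrite Hl|].
    intros x. simpl. fold (peval c x). rewrite Hp. ring. }
  apply poly_fun_ext with (2 := poly_fun_lincomb _ u v _ _ Hx (poly_fun_S _ _ Hf)).
  intros x. ring.
Qed.

Lemma poly_fun_cheb (u v : R) (n : nat) : poly_fun n (fun x => cheb n (u * x + v)).
Proof.
  induction n as [| |n IH1 IH2] using nat_two_step_ind.
  - exact (poly_fun_const 0 1).
  - apply poly_fun_ext with (2 := poly_fun_mul_affine 0 u v _ (poly_fun_const 0 1)).
    intros x. simpl. ring.
  - apply poly_fun_ext with
      (2 := poly_fun_lincomb _ 2 (-1) _ _ (poly_fun_mul_affine _ u v _ IH2)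
              (poly_fun_S _ _ (poly_fun_S _ _ IH1))).
    intros x. rewrite cheb_SS. ring.
Qed.

(** A vanishing leading coefficient is replaced by some [h > 0] with [B ^ n * h <= eta]; any other
    one is kept. *)
Lemma poly_fun_exact_degree (n : nat) (f : R -> R) (B eta : R) :
  poly_fun n f -> 0 <= B -> 0 < eta ->
  exists c, poly_deg c n /\
    forall x, 0 <= x <= B -> Rabs (peval c x - f x) <= eta.
Proof.
  intros [c [Hl Hp]] HB He.
  destruct (exists_last (l := c)) as [c' [a ->]]; [intros ->; discriminate|].
  rewrite length_app in Hl. simpl in Hl.
  assert (Hpow : 0 < 1 + B ^ n) by (pose proof (pow_le B n HB); lra).
  assert (Heval : forall (l : list R) e x,
    peval (l ++ e :: nil) x = peval l x + x ^ length l * e).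
  { intros l e x. induction l as [|h l IH].
    - simpl. ring.
    - simpl. fold (peval (l ++ e :: nil) x) (peval l x). rewrite IH. ring. }
  set (h := eta / (1 + B ^ n)).
  assert (Hh : 0 < h) by (now apply Rdiv_lt_0_compat).
  assert (Hhe : B ^ n * h <= eta).
  { apply Rle_trans with ((1 + B ^ n) * h); [lra|]. right. unfold h. field. lra. }
  set (a' := if Req_EM_T a 0 then h else a).
  exists (c' ++ a' :: nil). split; [split|].
  - rewrite length_app. simpl. lia.
  - rewrite last_last. unfold a'. destruct (Req_EM_T a 0); lra.
  - intros x Hx. rewrite <- Hp, !Heval. replace (length c') with n by lia.
    replace (peval c' x + x ^ n * a' - (peval c' x + x ^ n * a))
      with (x ^ n * (a' - a)) by ring.
    rewrite Rabs_mult, Rabs_pos_eq by (apply pow_le; lra).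
    assert (Rabs (a' - a) <= h).
    { unfold a'. destruct (Req_EM_T a 0) as [->|_].
      - rewrite Rabs_pos_eq; lra.
      - rewrite Rminus_diag, Rabs_R0. lra. }
    apply Rle_trans with (2 := Hhe).
    apply Rmult_le_compat; auto using Rabs_pos.
    + apply pow_le; lra.
    + now apply pow_incr.
Qed.

(** * Upper bound: truncated Chebyshev expansions *)

(* Truncating the (nonnegative) Chebyshev expansion of [t ^ m * cheb s t] after
   degree [n] loses only the terms of index [j > n], for which
   [1 <= 2 * cheb j t0 / rho ^ n]. *)
Lemma pow_cheb_approx (n : nat) (rho u v : R) (m s : nat) :
  1 <= rho ->
  let t0 := (rho + / rho) / 2 in
  exists P, poly_fun n P /\
    forall x, -1 <= u * x + v <= 1 ->
      Rabs (P x - (u * x + v) ^ m * cheb s (u * x + v))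
        <= 2 / rho ^ n * (t0 ^ m * cheb s t0).
Proof.
  intros Hrho t0.
  assert (Hn : 0 < rho ^ n) by (apply pow_lt; lra).
  revert s. induction m as [|m IH]; intros s.
  - assert (Hs : 0 < rho ^ s) by (apply pow_lt; lra).
    assert (Hs' : 0 < / rho ^ s) by now apply Rinv_0_lt_compat.
    assert (Hc : cheb s t0 = (rho ^ s + / rho ^ s) / 2).
    { apply cheb_joukowski. lra. }
    destruct (le_lt_dec s n) as [Hsn|Hsn].
    + exists (fun x => cheb s (u * x + v)). split.
      { apply (poly_fun_le s); auto. apply poly_fun_cheb. }
      intros x _. simpl. rewrite !Rmult_1_l, Rminus_diag, Rabs_R0, Hc.
      apply Rmult_le_pos; [|lra]. apply Rdiv_le_0_compat; lra.
    + exists (fun _ => 0). split; [apply poly_fun_const|].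
      intros x Hx. simpl. rewrite !Rmult_1_l, Rminus_0_l, Rabs_Ropp, Hc.
      apply Rle_trans with 1; [now apply cheb_abs_le_1|].
      apply Rle_trans with (2 / rho ^ n * (rho ^ n / 2)); [right; field; lra|].
      apply Rmult_le_compat_l; [apply Rdiv_le_0_compat; lra|].
      pose proof (Rle_pow rho n s Hrho ltac:(lia)). lra.
  - destruct s as [|s].
    + destruct (IH 1%nat) as [P [HP HE]]. exists P. split; auto.
      intros x Hx. specialize (HE x Hx). simpl in *.
      replace (t0 * t0 ^ m * 1) with (t0 ^ m * t0) by ring.
      replace ((u * x + v) * (u * x + v) ^ m * 1)
        with ((u * x + v) ^ m * (u * x + v)) by ring.
      exact HE.
    (* Since [t * cheb (S s) t] is the mean of [cheb s t] and [cheb (S (S s)) t], the two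
       approximants are averaged. The error bound is linear in the same quantities at [t0], so it
       follows the same identity. *)
    + destruct (IH s) as [P [HP HE]]. destruct (IH (S (S s))) as [Q [HQ HF]].
      exists (fun x => / 2 * P x + / 2 * Q x). split; [now apply poly_fun_lincomb|].
      intros x Hx. specialize (HE x Hx). specialize (HF x Hx).
      rewrite cheb_SS in HF. rewrite cheb_SS in HF. simpl pow.
      set (y := u * x + v) in *.
      match goal with |- Rabs ?X <= _ => replace X with
        (/ 2 * (P x - y ^ m * cheb s y)
          + / 2 * (Q x - y ^ m * (2 * y * cheb (S s) y - cheb s y))) by field end.
      eapply Rle_trans; [apply Rabs_triang|].
      rewrite !Rabs_mult, (Rabs_pos_eq (/ 2)) by lra.
      match goal with |- _ <= ?X => replace X with
        (/ 2 * (2 / rho ^ n * (t0 ^ m * cheb s t0)) + / 2 *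
          (2 / rho ^ n * (t0 ^ m * (2 * t0 * cheb (S s) t0 - cheb s t0))))
        by (field; lra) end.
      lra.
Qed.

(** The monomials (case [s = 0]) are summed with the nonnegative weights [b ^ m / m!]; their error
    bounds add up to the same Taylor sum at [b * t0]. *)
Lemma exp_taylor_cheb_approx (n : nat) (rho u v b : R) (M : nat) :
  1 <= rho -> 0 <= b ->
  let t0 := (rho + / rho) / 2 in
  exists P, poly_fun n P /\
    forall x, -1 <= u * x + v <= 1 ->
      Rabs (P x - exp_taylor M (b * (u * x + v)))
        <= 2 / rho ^ n * exp_taylor M (b * t0).
Proof.
  intros Hrho Hb t0. unfold exp_taylor. induction M as [|M [P [HP HE]]].
  - destruct (pow_cheb_approx n rho u v 0 0 Hrho) as [P [HP HE]]. exists P. split; auto.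
    intros x Hx. specialize (HE x Hx). simpl in *.
    replace (1 / 1) with (1 * 1) by field. exact HE.
  - destruct (pow_cheb_approx n rho u v (S M) 0 Hrho) as [Q [HQ HF]].
    set (m := S M) in *. set (w := b ^ m / INR (fact m)).
    assert (Hw : 0 <= w).
    { apply Rdiv_le_0_compat; [now apply pow_le | apply INR_fact_lt_0]. }
    exists (fun x => 1 * P x + w * Q x). split; [now apply poly_fun_lincomb|].
    intros x Hx. specialize (HE x Hx). specialize (HF x Hx).
    unfold m. rewrite ?tech5. fold m.
    rewrite !Rpow_mult_distr. simpl cheb in HF. rewrite !Rmult_1_r in HF.
    set (y := u * x + v) in *.
    set (s1 := sum_f_R0 (fun i => (b * y) ^ i / _) M) in *.
    set (s2 := sum_f_R0 (fun i => (b * t0) ^ i / _) M) in *.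
    replace (1 * P x + w * Q x - (s1 + b ^ m * y ^ m / INR (fact m)))
      with ((P x - s1) + w * (Q x - y ^ m)) by (unfold w, Rdiv; ring).
    replace (2 / rho ^ n * (s2 + b ^ m * t0 ^ m / INR (fact m)))
      with (2 / rho ^ n * s2 + w * (2 / rho ^ n * t0 ^ m)) by (unfold w, Rdiv; ring).
    eapply Rle_trans; [apply Rabs_triang|].
    rewrite Rabs_mult, (Rabs_pos_eq w) by assumption.
    apply Rplus_le_compat; auto. now apply Rmult_le_compat_l.
Qed.

Lemma good_approx_exp (b delta rho : R) (n : nat) :
  0 < b -> 1 <= rho -> (1 <= n)%nat ->
  2 / rho ^ n * exp (b + b * ((rho + / rho) / 2)) < delta ->
  good_approx (2 * b) delta exp n.
Proof.
  intros Hb Hr Hn Hd. split; auto.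
  set (E := 2 / rho ^ n * exp (b + b * ((rho + / rho) / 2))) in *.
  (* One third of the slack pays for the Taylor remainder, one for making the degree exact, and the
     last keeps the error strictly below [delta]. *)
  set (eta := (delta - E) / 3).
  assert (He : 0 < eta) by (unfold eta; lra).
  destruct (exp_taylor_uniform b (eta / exp b) 0) as [M [_ HM]]; [lra| |].
  { apply Rdiv_lt_0_compat; auto using exp_pos. }
  destruct (exp_taylor_cheb_approx n rho (/ b) (-1) b M Hr) as [P [HP HE]]; [lra|].
  (* The zero summand only gives [exp b * P] the shape of a linear combination. *)
  assert (HQ : poly_fun n (fun x => exp b * P x + 0 * P x)) by now apply poly_fun_lincomb.
  destruct (poly_fun_exact_degree n _ (2 * b) eta HQ) as [c [Hc Hcx]]; [lra|auto|].
  exists c. split; auto. exists (E + 2 * eta). split; [unfold eta; lra|].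
  intros x Hx. specialize (Hcx x Hx). cbv beta in Hcx.
  set (y := / b * x + -1) in *.
  assert (Hbi : 0 < / b) by now apply Rinv_0_lt_compat.
  assert (Hy : -1 <= y <= 1).
  { unfold y. split; [pose proof (Rmult_le_pos (/ b) x); lra|].
    assert (Hx' := Rmult_le_compat_l (/ b) _ _ (Rlt_le _ _ Hbi) (proj2 Hx)).
    replace (/ b * (2 * b)) with 2 in Hx' by (field; lra). lra. }
  specialize (HE x Hy). fold y in HE.
  assert (Hby : Rabs (b * y) <= b).
  { rewrite Rabs_mult, (Rabs_pos_eq b) by lra.
    rewrite <- (Rmult_1_r b) at 2. apply Rmult_le_compat_l; [lra|].
    now apply Rabs_le. }
  specialize (HM _ Hby).
  assert (Hexp : exp x = exp b * exp (b * y)).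
  { rewrite <- exp_plus. f_equal. unfold y. field. lra. }
  assert (H1 : exp b * Rabs (exp (b * y) - exp_taylor M (b * y)) <= eta).
  { apply Rmult_le_compat_l with (r := exp b) in HM; [|left; apply exp_pos].
    replace (exp b * (eta / exp b)) with eta in HM; auto.
    field. apply Rgt_not_eq, exp_pos. }
  assert (H2 : exp b * Rabs (P x - exp_taylor M (b * y)) <= E).
  { apply Rmult_le_compat_l with (r := exp b) in HE; [|left; apply exp_pos].
    eapply Rle_trans; [exact HE|]. unfold E. rewrite exp_plus.
    assert (Hri : 0 < / rho) by (apply Rinv_0_lt_compat; lra).
    assert (Hle : exp_taylor M (b * ((rho + / rho) / 2)) <= exp (b * ((rho + / rho) / 2))).
    { apply exp_taylor_le_exp. apply Rmult_le_pos; lra. }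
    assert (0 < 2 / rho ^ n) by (apply Rdiv_lt_0_compat; [lra | apply pow_lt; lra]).
    pose proof (exp_pos b).
    apply Rmult_le_compat_l with (r := exp b * (2 / rho ^ n)) in Hle.
    - lra.
    - apply Rmult_le_pos; lra. }
  rewrite Hexp.
  match goal with |- Rabs ?X <= _ => replace X with
    ((peval c x - (exp b * P x + 0 * P x))
     + (exp b * (P x - exp_taylor M (b * y))
        - exp b * (exp (b * y) - exp_taylor M (b * y)))) by ring end.
  eapply Rle_trans; [apply Rabs_triang|].
  eapply Rle_trans; [apply Rplus_le_compat; [exact Hcx | apply Rabs_triang]|].
  rewrite Rabs_Ropp, !Rabs_mult, (Rabs_pos_eq (exp b)) by (left; apply exp_pos).
  lra.
Qed.

(** * Cosine sums and the alternating mean *)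

(** The Dirichlet kernel, kept free of division so that [sin (x / 2) = 0] is allowed. *)
Lemma cos_sum_telescope (x : R) (K : nat) :
  sum_f_R0 (fun k => cos (INR k * x)) K * (2 * sin (x / 2))
    = sin ((INR K + 1 / 2) * x) + sin (x / 2).
Proof.
  induction K as [|K IH].
  - simpl. rewrite Rmult_0_l, cos_0. replace ((0 + 1 / 2) * x) with (x / 2) by field. ring.
  - rewrite tech5, Rmult_plus_distr_r, IH, S_INR.
    replace ((INR K + 1 + 1 / 2) * x) with ((INR K + 1) * x + x / 2) by field.
    replace ((INR K + 1 / 2) * x) with ((INR K + 1) * x - x / 2) by field.
    rewrite sin_plus, sin_minus. ring.
Qed.

Lemma cos_sum_full (x : R) (K : nat) : sin (x / 2) = 0 ->
  sum_f_R0 (fun k => cos (INR k * x)) K = INR (S K).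
Proof.
  intros H. rewrite <- (Rmult_1_l (INR (S K))), <- sum_cte. apply sum_eq. intros k _.
  destruct (sin_eq_0_0 _ H) as [z Hz].
  replace (INR k * x) with (2 * (INR k * (x / 2))) by field.
  rewrite Hz, cos_2a_sin.
  replace (INR k * (IZR z * PI)) with (IZR (Z.of_nat k * z) * PI)
    by (rewrite mult_IZR, <- INR_IZR_INZ; ring).
  rewrite (sin_eq_0_1 (IZR _ * PI)) by eauto. ring.
Qed.

(** Here [(2 * n + 1 + 1 / 2) * x = 2 * j * PI - x / 2], so the two sines of the Dirichlet kernel
    cancel. With [cos_sum_full], the sum is either zero or the number of points. *)
Lemma cos_sum_period (n : nat) (j : Z) :
  let x := IZR j * PI / INR (S n) in
  sin (x / 2) <> 0 -> sum_f_R0 (fun k => cos (INR k * x)) (S (2 * n)) = 0.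
Proof.
  intros x Hx. pose proof (cos_sum_telescope x (S (2 * n))) as H.
  assert (Hn : INR (S n) <> 0) by (apply not_0_INR; lia).
  replace ((INR (S (2 * n)) + 1 / 2) * x) with (2 * (IZR j * PI) - x / 2) in H.
  2:{ unfold x. rewrite !S_INR, mult_INR in *. simpl INR. field. auto. }
  rewrite sin_minus, sin_2a, cos_2a_sin in H.
  rewrite (sin_eq_0_1 (IZR j * PI)) in H by eauto.
  apply Rmult_eq_reg_r with (2 * sin (x / 2)); [rewrite H; ring | lra].
Qed.

Lemma pow_m1_cos (k : nat) : (-1) ^ k = cos (INR k * PI).
Proof.
  induction k as [|k IH].
  - simpl. now rewrite Rmult_0_l, cos_0.
  - rewrite S_INR, Rmult_plus_distr_r, Rmult_1_l, neg_cos, <- IH. simpl. ring.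
Qed.

(* The alternating mean over the [2 (n + 1)] points [k PI / (n + 1)]. As a functional of
   [g (cos u)] it vanishes on polynomials of degree at most [n] and is nonnegative on all
   Chebyshev polynomials, so it bounds the approximation error from below. *)
Definition altmean (n : nat) (g : R -> R) : R :=
  sum_f_R0 (fun k => (-1) ^ k * g (INR k * PI / INR (S n))) (S (2 * n)) / INR (2 * S n).

Lemma altmean_ext (n : nat) (f g : R -> R) :
  (forall u, f u = g u) -> altmean n f = altmean n g.
Proof.
  intros H. unfold altmean. f_equal. apply sum_eq. intros k _. now rewrite H.
Qed.

Lemma altmean_lincomb (n : nat) (a b : R) (f g : R -> R) :
  altmean n (fun u => a * f u + b * g u) = a * altmean n f + b * altmean n g.
Proof.
  unfold altmean, Rdiv. rewrite <- !Rmult_assoc, !scal_sum, <- Rmult_plus_distr_r, <- sum_plus.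
  f_equal. apply sum_eq. intros k _. ring.
Qed.

Lemma altmean_abs_le (n : nat) (f : R -> R) (e : R) :
  (forall u, Rabs (f u) <= e) -> Rabs (altmean n f) <= e.
Proof.
  intros H. unfold altmean.
  assert (Hn : 0 < INR (2 * S n)) by (apply lt_0_INR; lia).
  unfold Rdiv. rewrite Rabs_mult, (Rabs_pos_eq (/ _)).
  2:{ left. now apply Rinv_0_lt_compat. }
  apply Rmult_le_reg_r with (INR (2 * S n)); auto.
  rewrite Rmult_assoc, Rinv_l, Rmult_1_r by lra.
  eapply Rle_trans; [apply Rsum_abs|].
  replace (2 * S n)%nat with (S (S (2 * n))) by lia.
  rewrite <- sum_cte. apply sum_Rle. intros k _.
  now rewrite Rabs_mult, pow_1_abs, Rmult_1_l.
Qed.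

(** The sign [(-1) ^ k] is [cos (k * PI)], and the product formula for cosines moves the frequency
    [s] to [s + (n + 1)] and [s - (n + 1)]. *)
Lemma altmean_cos (n : nat) (s : Z) :
  altmean n (fun u => cos (IZR s * u)) =
  (sum_f_R0 (fun k => cos (INR k * (IZR (s + Z.of_nat (S n)) * PI / INR (S n)))) (S (2 * n))
   + sum_f_R0 (fun k => cos (INR k * (IZR (s - Z.of_nat (S n)) * PI / INR (S n)))) (S (2 * n)))
  / (2 * INR (2 * S n)).
Proof.
  assert (Hn : INR (S n) <> 0) by (apply not_0_INR; lia).
  assert (Hn2 : INR (2 * S n) <> 0) by (apply not_0_INR; lia).
  unfold altmean. rewrite <- sum_plus.
  replace (/ (2 * INR (2 * S n))) with (/ 2 * / INR (2 * S n)) by (field; auto).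
  unfold Rdiv at 1 3. rewrite (Rinv_mult 2), <- Rmult_assoc. f_equal.
  rewrite Rmult_comm, scal_sum. apply sum_eq. intros k _.
  rewrite plus_IZR, minus_IZR, <- INR_IZR_INZ, pow_m1_cos.
  set (v := IZR s * (INR k * PI / INR (S n))).
  replace (INR k * ((IZR s + INR (S n)) * PI / INR (S n))) with (v + INR k * PI)
    by (unfold v; field; auto).
  replace (INR k * ((IZR s - INR (S n)) * PI / INR (S n))) with (v - INR k * PI)
    by (unfold v; field; auto).
  rewrite cos_plus, cos_minus. field.
Qed.

Lemma altmean_cos_nonneg (n : nat) (s : Z) : 0 <= altmean n (fun u => cos (IZR s * u)).
Proof.
  rewrite altmean_cos.
  assert (Hn : 0 < INR (2 * S n)) by (apply lt_0_INR; lia).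
  assert (H : forall j : Z, 0 <=
    sum_f_R0 (fun k => cos (INR k * (IZR j * PI / INR (S n)))) (S (2 * n))).
  { intros j. destruct (Req_dec (sin (IZR j * PI / INR (S n) / 2)) 0) as [H|H].
    - rewrite (cos_sum_full _ _ H). apply pos_INR.
    - rewrite (cos_sum_period _ _ H). lra. }
  apply Rdiv_le_0_compat; [|lra].
  now apply Rplus_le_le_0_compat.
Qed.

(** For such [s], neither [s + (n + 1)] nor [s - (n + 1)] is a multiple of [2 * (n + 1)], so both
    sums vanish. *)
Lemma altmean_cos_zero (n : nat) (s : Z) : (Z.abs s <= Z.of_nat n)%Z ->
  altmean n (fun u => cos (IZR s * u)) = 0.
Proof.
  intros Hs. rewrite altmean_cos.
  assert (Hn : 0 < INR (S n)) by (apply lt_0_INR; lia).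
  pose proof PI_RGT_0 as Hpi.
  assert (H : forall j : Z, (0 < j < 2 * Z.of_nat (S n))%Z ->
    0 < sin (IZR j * PI / INR (S n) / 2)).
  { intros j [Hj1 Hj2]. apply IZR_lt in Hj1, Hj2.
    rewrite mult_IZR, <- INR_IZR_INZ in Hj2.
    apply sin_gt_0.
    - apply Rdiv_lt_0_compat; [|lra]. apply Rdiv_lt_0_compat; auto.
      now apply Rmult_lt_0_compat.
    - apply Rmult_lt_reg_r with (2 * INR (S n)); [lra|].
      replace (IZR j * PI / INR (S n) / 2 * (2 * INR (S n))) with (IZR j * PI)
        by (field; lra).
      rewrite (Rmult_comm PI). now apply Rmult_lt_compat_r. }
  rewrite !cos_sum_period.
  - unfold Rdiv. ring.
  - specialize (H (Z.of_nat (S n) - s)%Z ltac:(lia)).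
    replace (s - Z.of_nat (S n))%Z with (- (Z.of_nat (S n) - s))%Z by ring.
    rewrite opp_IZR.
    match goal with |- sin ?X <> 0 => replace X with
      (- (IZR (Z.of_nat (S n) - s) * PI / INR (S n) / 2)) by (field; lra) end.
    rewrite sin_neg. lra.
  - apply Rgt_not_eq, H. lia.
Qed.

Lemma altmean_cos_top (n : nat) : altmean n (fun u => cos (IZR (Z.of_nat (S n)) * u)) = 1.
Proof.
  assert (Hn : 0 < INR (S n)) by (apply lt_0_INR; lia).
  rewrite altmean_cos, !cos_sum_full.
  - replace (S (S (2 * n))) with (2 * S n)%nat by lia. field. apply not_0_INR. lia.
  - replace (Z.of_nat (S n) - Z.of_nat (S n))%Z with 0%Z by ring.
    unfold Rdiv. rewrite !Rmult_0_l. apply sin_0.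
  - rewrite plus_IZR, <- INR_IZR_INZ.
    replace ((INR (S n) + INR (S n)) * PI / INR (S n) / 2) with PI by (field; lra).
    apply sin_PI.
Qed.

Lemma cos_mul_cos_IZR (s : Z) (u : R) :
  cos u * cos (IZR s * u) = / 2 * cos (IZR (s + 1) * u) + / 2 * cos (IZR (s - 1) * u).
Proof.
  rewrite plus_IZR, minus_IZR.
  replace ((IZR s + 1) * u) with (IZR s * u + u) by ring.
  replace ((IZR s - 1) * u) with (IZR s * u - u) by ring.
  rewrite cos_plus, cos_minus. field.
Qed.

Lemma altmean_mul_cos (n : nat) (g : R -> R) (s : Z) :
  altmean n (fun u => g u * cos u * cos (IZR s * u)) =
  / 2 * altmean n (fun u => g u * cos (IZR (s + 1) * u))
  + / 2 * altmean n (fun u => g u * cos (IZR (s - 1) * u)).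
Proof.
  rewrite <- altmean_lincomb. apply altmean_ext. intros u.
  rewrite Rmult_assoc, cos_mul_cos_IZR. ring.
Qed.

(** Each Horner step multiplies by [cos u], which moves [s] by one either way. The hypothesis is
    kept by trading one coefficient for one unit of frequency. *)
Lemma altmean_peval (n : nat) (a b : R) (c : list R) (s : Z) :
  (Z.abs s + Z.of_nat (length c) <= Z.of_nat (S n))%Z ->
  altmean n (fun u => peval c (a + b * cos u) * cos (IZR s * u)) = 0.
Proof.
  revert s. induction c as [|h c IH]; intros s Hs.
  - rewrite (altmean_ext _ _ (fun u => 0 * cos (IZR s * u) + 0 * cos (IZR s * u))).
    + rewrite altmean_lincomb. ring.
    + intros u. simpl. ring.
  - simpl length in Hs.
    rewrite (altmean_ext _ _ (fun u => h * cos (IZR s * u) +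
       1 * (a * (peval c (a + b * cos u) * cos (IZR s * u))
        + b * (peval c (a + b * cos u) * cos u * cos (IZR s * u))))).
    2:{ intros u. simpl. fold (peval c (a + b * cos u)). ring. }
    rewrite altmean_lincomb, (altmean_lincomb _ a b), altmean_mul_cos.
    rewrite altmean_cos_zero, !IH by lia. ring.
Qed.

Lemma altmean_pow_nonneg (n m : nat) (s : Z) :
  0 <= altmean n (fun u => cos u ^ m * cos (IZR s * u)).
Proof.
  revert s. induction m as [|m IH]; intros s.
  - rewrite (altmean_ext _ _ (fun u => cos (IZR s * u))) by (intros u; simpl; ring).
    apply altmean_cos_nonneg.
  - rewrite (altmean_ext _ _ (fun u => cos u ^ m * cos u * cos (IZR s * u)))
      by (intros u; simpl; ring).
    rewrite altmean_mul_cos.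
    pose proof (IH (s + 1)%Z). pose proof (IH (s - 1)%Z). lra.
Qed.

(** The left side is a binomial coefficient over [2 ^ (i + j)]: the weight of the walks with [j]
    steps up and [i] steps down, which lead from [s] to [n + 1], where the mean is 1. All other
    walks contribute nonnegatively. *)
Lemma altmean_pow_ge (n i j : nat) (s : Z) :
  (s + Z.of_nat j - Z.of_nat i = Z.of_nat (S n))%Z ->
  INR (fact (i + j)) / (INR (fact i) * INR (fact j) * 2 ^ (i + j))
    <= altmean n (fun u => cos u ^ (i + j) * cos (IZR s * u)).
Proof.
  assert (Hstep : forall m s, altmean n (fun u => cos u ^ S m * cos (IZR s * u)) =
    / 2 * altmean n (fun u => cos u ^ m * cos (IZR (s + 1) * u))
    + / 2 * altmean n (fun u => cos u ^ m * cos (IZR (s - 1) * u))).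
  { intros m z. rewrite <- altmean_mul_cos. apply altmean_ext. intros u. simpl. ring. }
  revert j s. induction i as [|i IHi].
  - induction j as [|j IHj]; intros s Hs.
    + replace s with (Z.of_nat (S n)) by lia. simpl plus.
      rewrite (altmean_ext _ _ (fun u => cos (IZR (Z.of_nat (S n)) * u)))
        by (intros u; simpl; ring).
      rewrite altmean_cos_top. simpl. lra.
    + change (0 + S j)%nat with (S j). change (0 + j)%nat with j in IHj. rewrite (Hstep j s).
      specialize (IHj (s + 1)%Z ltac:(lia)).
      pose proof (altmean_pow_nonneg n j (s - 1)).
      assert (Hf : forall k, INR (fact k) <> 0) by apply INR_fact_neq_0.
      assert (H2 : forall k, 2 ^ k <> 0) by (intros k; apply pow_nonzero; lra).
      replace (INR (fact (S j)) / (INR (fact 0) * INR (fact (S j)) * 2 ^ S j))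
        with (/ 2 * (INR (fact j) / (INR (fact 0) * INR (fact j) * 2 ^ j)))
        by (simpl pow; field; auto).
      lra.
  - induction j as [|j IHj]; intros s Hs.
    + specialize (IHi 0%nat (s - 1)%Z ltac:(lia)).
      rewrite Nat.add_0_r in *. rewrite Hstep.
      pose proof (altmean_pow_nonneg n i (s + 1)).
      assert (Hf : forall k, INR (fact k) <> 0) by apply INR_fact_neq_0.
      assert (H2 : forall k, 2 ^ k <> 0) by (intros k; apply pow_nonzero; lra).
      replace (INR (fact (S i)) / (INR (fact (S i)) * INR (fact 0) * 2 ^ S i))
        with (/ 2 * (INR (fact i) / (INR (fact i) * INR (fact 0) * 2 ^ i)))
        by (simpl pow; field; auto).
      lra.
    + specialize (IHi (S j) (s - 1)%Z ltac:(lia)).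
      specialize (IHj (s + 1)%Z ltac:(lia)).
      replace (S i + S j)%nat with (S (S (i + j))) by lia.
      replace (i + S j)%nat with (S (i + j)) in IHi by lia.
      replace (S i + j)%nat with (S (i + j)) in IHj by lia.
      rewrite Hstep.
      (* Pascal's rule. *)
      assert (Hp : INR (fact (S (S (i + j)))) /
          (INR (fact (S i)) * INR (fact (S j)) * 2 ^ S (S (i + j)))
        = / 2 * (INR (fact (S (i + j))) / (INR (fact (S i)) * INR (fact j) * 2 ^ S (i + j)))
        + / 2 * (INR (fact (S (i + j))) / (INR (fact i) * INR (fact (S j)) * 2 ^ S (i + j)))).
      { rewrite !fact_simpl, !mult_INR, !S_INR, plus_INR. simpl pow.
        assert (Hf : forall k, INR (fact k) <> 0) by apply INR_fact_neq_0.
        pose proof (pos_INR i). pose proof (pos_INR j).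
        field. repeat split; auto; try lra. apply pow_nonzero; lra. }
      rewrite Hp. lra.
Qed.

(** All Taylor terms have nonnegative mean, so one may be singled out. In degree [i + (S n + i)] the
    factorial of the degree cancels, which leaves the term of index [i] of the Bessel series of
    [I_(n+1)] at [b]. *)
Lemma altmean_exp_taylor_ge (n i M : nat) (b : R) : 0 <= b -> (i + (S n + i) <= M)%nat ->
  (b / 2) ^ (i + (S n + i)) / (INR (fact i) * INR (fact (S n + i)))
    <= altmean n (fun u => exp_taylor M (b * cos u)).
Proof.
  intros Hb. set (m := (i + (S n + i))%nat).
  assert (Hf : forall k, 0 < INR (fact k)) by apply INR_fact_lt_0.
  assert (Hstep : forall k, altmean n (fun u => exp_taylor (S k) (b * cos u)) =
    altmean n (fun u => exp_taylor k (b * cos u))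
    + b ^ S k / INR (fact (S k)) * altmean n (fun u => cos u ^ S k * cos (IZR 0 * u))).
  { intros k. rewrite <- (Rmult_1_l (altmean n (fun u => exp_taylor k _))).
    rewrite <- altmean_lincomb. apply altmean_ext. intros u.
    unfold exp_taylor. rewrite tech5, Rmult_0_l, cos_0, Rpow_mult_distr.
    unfold Rdiv. ring. }
  assert (Hpos : forall k, 0 <= b ^ S k / INR (fact (S k)) *
    altmean n (fun u => cos u ^ S k * cos (IZR 0 * u))).
  { intros k. apply Rmult_le_pos; [|apply altmean_pow_nonneg].
    apply Rdiv_le_0_compat; auto. now apply pow_le. }
  assert (Hnn : forall k, 0 <= altmean n (fun u => exp_taylor k (b * cos u))).
  { induction k as [|k IH].
    - rewrite (altmean_ext _ _ (fun u => cos (IZR 0 * u))); [apply altmean_cos_nonneg|].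
      intros u. unfold exp_taylor. simpl. rewrite Rmult_0_l, cos_0. field.
    - rewrite Hstep. specialize (Hpos k). lra. }
  intros HM. induction HM as [|M HM IH].
  - set (k := (i + (n + i))%nat).
    replace m with (S k) by (unfold m, k; lia). rewrite Hstep.
    pose proof (altmean_pow_ge n i (S n + i) 0 ltac:(lia)) as H.
    replace (i + (S n + i))%nat with (S k) in H by (unfold k; lia).
    apply Rmult_le_compat_l with (r := b ^ S k / INR (fact (S k))) in H.
    2:{ apply Rdiv_le_0_compat; auto. now apply pow_le. }
    specialize (Hnn k).
    replace ((b / 2) ^ S k / (INR (fact i) * INR (fact (S n + i)))) with
      (b ^ S k / INR (fact (S k)) * (INR (fact (S k)) /
       (INR (fact i) * INR (fact (S n + i)) * 2 ^ S k))).
    + lra.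
    + replace (b / 2) with (b * / 2) by reflexivity. rewrite Rpow_mult_distr, pow_inv.
      field. repeat split; try apply Rgt_not_eq; try apply Hf. apply pow_lt; lra.
  - rewrite Hstep. specialize (Hpos M). lra.
Qed.

(** * Lower bound on the approximation error *)

(** The mean annihilates the approximant, so the mean of the error at [x = b + b * cos u] is that of
    [exp] alone, while it cannot exceed the largest error. *)
Lemma good_approx_exp_lower (b delta : R) (n N i : nat) :
  0 < b -> good_approx (2 * b) delta exp n -> (n < N)%nat ->
  exp b * ((b / 2) ^ (i + (N + i)) / (INR (fact i) * INR (fact (N + i)))) < delta.
Proof.
  intros Hb [Hn [c [[Hlen _] [eps [Heps Happ]]]]] HN.
  (* [altmean N] uses [2 * (N + 1)] points and kills degrees up to [N]; hence the shift by one. *)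
  destruct N as [|N]; [lia|].
  apply Rle_lt_trans with (2 := Heps).
  (* An arbitrary [eta] pays for replacing [exp] by a Taylor sum. *)
  apply le_epsilon. intros eta Heta.
  destruct (exp_taylor_uniform b (eta / exp b) (i + (S N + i))) as [M [HM HT]]; [lra| |].
  { apply Rdiv_lt_0_compat; auto using exp_pos. }
  pose proof (altmean_exp_taylor_ge N i M b ltac:(lra) HM) as Hge.
  set (X := _ / (INR (fact i) * _)) in *.
  pose proof (exp_pos b) as Hexp.
  assert (Hz : altmean N (fun u => peval c (b + b * cos u) * cos (IZR 0 * u)) = 0).
  { apply altmean_peval. rewrite Hlen. lia. }
  assert (Habs : Rabs (altmean N (fun u => exp b * exp_taylor M (b * cos u)
      + (-1) * (peval c (b + b * cos u) * cos (IZR 0 * u)))) <= eps + eta).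
  { apply altmean_abs_le. intros u.
    pose proof (COS_bound u) as Hc.
    assert (Hx : 0 <= b + b * cos u <= 2 * b) by nra.
    specialize (Happ _ Hx).
    assert (Hbc : Rabs (b * cos u) <= b) by (apply Rabs_le; nra).
    specialize (HT _ Hbc).
    apply Rmult_le_compat_l with (r := exp b) in HT; [|lra].
    replace (exp b * (eta / exp b)) with eta in HT by (field; lra).
    rewrite <- (Rabs_pos_eq (exp b)) in HT at 1 by lra. rewrite <- Rabs_mult in HT.
    rewrite Rmult_0_l, cos_0. rewrite exp_plus in Happ.
    match goal with |- Rabs ?Y <= _ => replace Y with
      (- (peval c (b + b * cos u) - exp b * exp (b * cos u))
       + - (exp b * (exp (b * cos u) - exp_taylor M (b * cos u)))) by ring end.
    eapply Rle_trans; [apply Rabs_triang|]. rewrite !Rabs_Ropp. lra. }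
  rewrite altmean_lincomb, Hz in Habs.
  apply Rabs_le_between in Habs.
  apply Rmult_le_compat_l with (r := exp b) in Hge; lra.
Qed.

(** * Estimates for logarithms and factorials *)

Lemma nat_between (x : R) : 0 <= x -> exists N : nat, x < INR N <= x + 1.
Proof.
  intros Hx. destruct (nfloor_ex x Hx) as [n [H1 H2]].
  exists (S n). rewrite S_INR. lra.
Qed.

Lemma ln_le_sub_1 (x : R) : 0 < x -> ln x <= x - 1.
Proof.
  intros Hx. pose proof (exp_ineq1_le (ln x)) as H. rewrite exp_ln in H by auto. lra.
Qed.

(** The tangent to [ln] at [/ c], raised by 1; a small [c] makes a logarithm negligible against a
    linear term. *)
Lemma ln_le_linear (c x : R) : 0 < c -> 0 < x -> ln x <= c * x - ln c.
Proof.
  intros Hc Hx. pose proof (ln_le_sub_1 (c * x) (Rmult_lt_0_compat _ _ Hc Hx)) as H.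
  rewrite ln_mult in H by auto. lra.
Qed.

Lemma ln_2_lt_1 : ln 2 < 1.
Proof.
  pose proof exp_ineq1 1 ltac:(lra). rewrite <- (ln_exp 1). apply ln_increasing; lra.
Qed.

Lemma ln_nonneg (x : R) : 1 <= x -> 0 <= ln x.
Proof. intros H. rewrite <- ln_1. apply ln_le; lra. Qed.

(** A form of Stirling's upper bound. The induction step amounts to
    [(m + 2) * ln ((m + 2) / (m + 1)) >= 1]. *)
Lemma ln_fact_le (m : nat) :
  ln (INR (fact m)) <= (INR m + 1) * ln (INR m + 1) - INR m.
Proof.
  induction m as [|m IH].
  - simpl. rewrite Rplus_0_l, ln_1. lra.
  - rewrite fact_simpl, mult_INR, S_INR.
    pose proof (pos_INR m) as Hm. pose proof (INR_fact_lt_0 m).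
    rewrite ln_mult by lra. set (x := INR m) in *.
    assert (H1 : ln ((x + 1) / (x + 2)) <= - / (x + 2)).
    { eapply Rle_trans; [apply ln_le_sub_1; apply Rdiv_lt_0_compat; lra|].
      right. field. lra. }
    rewrite ln_div in H1 by lra.
    replace (x + 1 + 1) with (x + 2) by ring.
    apply Rmult_le_compat_l with (r := x + 2) in H1; [|lra].
    replace ((x + 2) * - / (x + 2)) with (-1) in H1 by (field; lra). nra.
Qed.

(** Serves for an index [m] obtained by rounding a real optimum [A]. The constant is [2 + 4 / A + 1]
    at [A = 1], its last summand coming from [m >= A - 1]. *)
Lemma ln_fact_le_near (m : nat) (A : R) : 1 <= A -> A - 1 <= INR m <= A + 1 ->
  ln (INR (fact m)) <= A * ln A - A + 2 * ln A + 7.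
Proof.
  intros HA Hm. eapply Rle_trans; [apply ln_fact_le|].
  assert (H1 : (INR m + 1) * ln (INR m + 1) <= (A + 2) * ln (A + 2)).
  { apply Rmult_le_compat; try lra.
    - apply ln_nonneg. lra.
    - apply ln_le; lra. }
  assert (H2 : ln (A + 2) <= ln A + 2 / A).
  { replace (A + 2) with (A * (1 + 2 / A)) by (field; lra).
    assert (0 < 2 / A) by (apply Rdiv_lt_0_compat; lra).
    rewrite ln_mult by lra. pose proof (ln_le_sub_1 (1 + 2 / A)). lra. }
  apply Rmult_le_compat_l with (r := A + 2) in H2; [|lra].
  replace ((A + 2) * (ln A + 2 / A)) with (A * ln A + 2 * ln A + 2 + 4 * / A) in H2
    by (field; lra).
  assert (/ A <= 1) by (rewrite <- Rinv_1; apply Rinv_le_contravar; lra).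
  lra.
Qed.

(** The crude [m! <= m ^ m] suffices when [B / L] tends to 0: a loss of order [m] is negligible
    against [m * ln (L / B)]. *)
Lemma ln_fact_le_simple (m : nat) : (1 <= m)%nat -> ln (INR (fact m)) <= INR m * ln (INR m).
Proof.
  induction m as [|m IH]; [lia|]. intros _. destruct m as [|m].
  - simpl. rewrite ln_1. lra.
  - specialize (IH ltac:(lia)). rewrite fact_simpl, mult_INR, (S_INR (S m)).
    set (x := INR (S m)) in *.
    assert (Hx : 0 < x) by (apply lt_0_INR; lia).
    rewrite ln_mult by (try apply INR_fact_lt_0; lra).
    assert (ln x <= ln (x + 1)) by (apply ln_le; lra). nra.
Qed.

(** * Both bounds in logarithmic form and in terms of [G] *)

Lemma good_approx_exp_log (b delta rho : R) (n : nat) :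
  0 < b -> 0 < delta -> 1 <= rho -> (1 <= n)%nat ->
  b + b * ((rho + / rho) / 2) - INR n * ln rho + ln 2 < - ln (/ delta) ->
  good_approx (2 * b) delta exp n.
Proof.
  intros Hb Hd Hr Hn H. apply (good_approx_exp b delta rho n); auto.
  rewrite ln_Rinv, Ropp_involutive in H by auto.
  apply exp_increasing in H. rewrite exp_ln in H by auto.
  replace (2 / rho ^ n) with (exp (- (INR n * ln rho) + ln 2)).
  - rewrite <- exp_plus. eapply Rle_lt_trans; [|exact H]. right. f_equal. ring.
  - rewrite exp_plus, exp_Ropp, exp_ln by lra.
    rewrite <- ln_pow, exp_ln; [field|apply pow_lt|]; try lra.
    apply pow_nonzero; lra.
Qed.

Lemma good_approx_exp_lower_log (b delta : R) (n N i : nat) :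
  0 < b -> 0 < delta -> good_approx (2 * b) delta exp n -> (n < N)%nat ->
  b + (INR i + INR (N + i)) * ln (b / 2) - ln (INR (fact i)) - ln (INR (fact (N + i)))
    < - ln (/ delta).
Proof.
  intros Hb Hd H HN.
  apply (good_approx_exp_lower b delta n N i) in H; auto.
  assert (Hf : forall k, 0 < INR (fact k)) by apply INR_fact_lt_0.
  pose proof (Hf i). pose proof (Hf (N + i)%nat).
  assert (Hp : 0 < (b / 2) ^ (i + (N + i))) by (apply pow_lt; lra).
  assert (Hff : 0 < INR (fact i) * INR (fact (N + i))) by (now apply Rmult_lt_0_compat).
  apply ln_increasing in H.
  2:{ apply Rmult_lt_0_compat; [apply exp_pos|]. now apply Rdiv_lt_0_compat. }
  rewrite ln_mult in H by (try apply exp_pos; now apply Rdiv_lt_0_compat).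
  rewrite ln_exp, ln_div, ln_mult, ln_pow, plus_INR in H by (auto; lra).
  rewrite ln_Rinv by auto. lra.
Qed.

Lemma sqrt_sq_1_gt (z : R) : 0 < z -> z < sqrt (z ^ 2 + 1) < z + 1.
Proof.
  intros Hz. rewrite <- (sqrt_pow2 z) at 1 by lra.
  rewrite <- (sqrt_pow2 (z + 1)) by lra.
  split; apply sqrt_lt_1; nra.
Qed.

(** Difference of squares. For [rho = sqrt (z ^ 2 + 1) + z] it identifies the logarithm in [G z] as
    [- ln rho]. *)
Lemma sqrt_sq_1_conj (z : R) : 
  (sqrt (z ^ 2 + 1) - z) * (sqrt (z ^ 2 + 1) + z) = 1.
Proof.
  pose proof (sqrt_sqrt (z ^ 2 + 1) ltac:(nra)). nra.
Qed.

(** The algebraic terms of the derivative cancel and leave [ln (sqrt (x ^ 2 + 1) - x)], negative for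
    [x > 0]. *)
Lemma G_decreasing (x y : R) : 0 < x -> x < y -> G y < G x.
Proof.
  intros Hx Hxy. apply Ropp_lt_cancel.
  apply (incr_function (fun x => - G x) 0 p_infty (fun x => - ln (sqrt (x ^ 2 + 1) - x)));
    simpl; auto.
  - intros z Hz _. pose proof (sqrt_sq_1_gt z Hz) as Hs.
    unfold G. auto_derive.
    + repeat split; simpl; try nra. simpl in Hs. lra.
    + simpl in Hs. set (q := sqrt (z * (z * 1) + 1)) in *. change (q - z) with (q + - z). field.
      split; lra.
  - intros z Hz _. pose proof (sqrt_sq_1_gt z Hz) as Hs. simpl in Hs.
    enough (ln (sqrt (z * (z * 1) + 1) - z) < 0) by lra.
    rewrite <- ln_1. apply ln_increasing; lra.
Qed.

Lemma good_approx_exp_G (b delta z : R) (n : nat) :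
  0 < b -> 0 < delta -> 0 < z -> (1 <= n)%nat -> z * b <= INR n ->
  b * (1 + G z) + ln 2 < - ln (/ delta) ->
  good_approx (2 * b) delta exp n.
Proof.
  intros Hb Hd Hz Hn Hzn H. unfold G in H.
  pose proof (sqrt_sq_1_gt z Hz) as Hs. pose proof (sqrt_sq_1_conj z) as Hc.
  set (q := sqrt (z ^ 2 + 1)) in *.
  assert (Hinv : / (q + z) = q - z).
  { apply Rmult_eq_reg_r with (q + z); [|lra]. rewrite Hc. field. lra. }
  assert (H1 : 1 <= q + z) by nra.
  apply (good_approx_exp_log b delta (q + z) n); auto.
  rewrite Hinv. rewrite <- Hinv, ln_Rinv in H by lra.
  pose proof (ln_nonneg _ H1).
  replace ((q + z + (q - z)) / 2) with q by field. nra.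
Qed.

(** The consecutive terms balance where [A * (A + z * b) = (b / 2) ^ 2], that is
    [A = (sqrt (z ^ 2 + 1) - z) * b / 2]. The assumptions give [A >= 1] and [ln (b / 2) >= 0]. *)
Lemma good_approx_exp_lower_G (b delta z : R) (n : nat) :
  0 < b -> 0 < delta -> 0 < z -> 2 <= b -> 2 <= (sqrt (z ^ 2 + 1) - z) * b ->
  good_approx (2 * b) delta exp n -> INR n < z * b ->
  b * (1 + G z) - 6 * ln (b / 2) - 14 < - ln (/ delta).
Proof.
  intros Hb Hd Hz Hb2 Hk Hg Hn. unfold G.
  pose proof (sqrt_sq_1_gt z Hz) as Hs. pose proof (sqrt_sq_1_conj z) as Hc.
  set (q := sqrt (z ^ 2 + 1)) in *.
  assert (Hzb : 0 < z * b) by now apply Rmult_lt_0_compat.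
  destruct (nat_between (z * b)) as [N HN]; [lra|].
  destruct (nfloor_ex ((q - z) * b / 2)) as [i Hi]; [lra|].
  assert (HnN : (n < N)%nat) by (apply INR_lt; lra).
  (* [i] is (nearly) the index of the largest term of the series of the Bessel function
     [I_N(b)]. *)
  pose proof (good_approx_exp_lower_log b delta n N i Hb Hd Hg HnN) as H.
  set (A := (q - z) * b / 2) in *. set (A' := (q + z) * b / 2).
  assert (HA : 1 <= A) by (unfold A; lra).
  assert (HAA : A' = A + z * b) by (unfold A, A'; field).
  assert (HA' : 1 <= A') by lra.
  assert (HN' : A' - 1 <= INR (N + i) <= A' + 1) by (rewrite plus_INR; lra).
  pose proof (ln_fact_le_near i A HA ltac:(lra)) as H1.
  pose proof (ln_fact_le_near (N + i) A' HA' HN') as H2.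
  pose proof (ln_nonneg (b / 2) ltac:(lra)) as Hl.
  assert (HlA : ln A = ln (b / 2) + ln (q - z)).
  { rewrite <- ln_mult by lra. f_equal. unfold A. field. }
  assert (HlA' : ln A' = ln (b / 2) - ln (q - z)).
  { replace (q - z) with (/ (q + z)).
    - rewrite ln_Rinv by lra. unfold Rminus. rewrite Ropp_involutive, <- ln_mult by lra.
      f_equal. unfold A'. field.
    - apply Rmult_eq_reg_r with (q + z); [|lra]. rewrite Hc. field. lra. }
  rewrite HlA in H1. rewrite HlA' in H2.
  set (l := ln (b / 2)) in *. set (w := ln (q - z)) in *.
  (* Rounding both indices costs [2 * l], the two factorials cost [4 * l] and [7 + 7]: hence [6] and
     [14]. *)
  assert (H3 : (A + A' - 2) * l <= (INR i + INR (N + i)) * l).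
  { apply Rmult_le_compat_r; lra. }
  assert (H4 : A' * w = A * w + z * b * w) by (rewrite HAA; ring).
  assert (H5 : A + A' = b * q) by (unfold A, A'; field).
  replace (b * (1 + (q + z * w))) with (b + b * q + z * b * w) by ring.
  lra.
Qed.

(** * Limits of the minimal degree *)

Lemma is_lim_seq_sandwich (u : nat -> R) (l : R) :
  (forall e, 0 < e -> eventually (fun k => u k <= l + e)) ->
  (forall e, 0 < e -> eventually (fun k => l - e <= u k)) ->
  is_lim_seq u l.
Proof.
  intros H1 H2. apply is_lim_seq_spec. intros e.
  assert (He : 0 < e / 2) by (pose proof (cond_pos e); lra).
  generalize (filter_and _ _ (H1 _ He) (H2 _ He)). apply filter_imp.
  intros k [Hk1 Hk2]. pose proof (cond_pos e). apply Rabs_def1; lra.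
Qed.

(** Serves two regimes: [l = / r] and [l = 0]. Moving [z] off [z0] opens a gap [g] in [G], and
    [g * b] outgrows the constant and logarithmic losses. *)
Lemma min_deg_exp_lim (b delta : nat -> R) (d : nat -> nat) (z0 l : R) :
  (forall k, 0 < b k) -> (forall k, 0 < delta k) ->
  (forall k, is_min_deg (2 * b k) (delta k) exp (d k)) ->
  is_lim_seq b p_infty -> is_lim_seq (fun k => ln (/ delta k) / b k) l ->
  0 < z0 -> G z0 = -1 - l ->
  is_lim_seq (fun k => INR (d k) / b k) z0.
Proof.
  intros Hb Hd Hmin Hbi Hl Hz HG.
  apply is_lim_seq_spec in Hbi. apply is_lim_seq_spec in Hl.
  simpl in Hbi, Hl.
  apply is_lim_seq_sandwich; intros e He.
  (* The other [e / 2] absorbs rounding [z * b] up to an integer. *)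
  - set (z := z0 + e / 2).
    assert (Hg : 0 < G z0 - G z).
    { pose proof (G_decreasing z0 z Hz ltac:(unfold z; lra)). lra. }
    set (g := G z0 - G z) in *.
    assert (Hg2 : 0 < g / 2) by lra.
    generalize (filter_and _ _ (filter_and _ _ (Hbi (2 / e)) (Hbi (2 / g)))
                  (Hl (mkposreal _ Hg2))).
    apply filter_imp. intros k [[H1 H2] H3]. simpl in H3.
    specialize (Hb k). specialize (Hd k). specialize (Hmin k).
    set (bk := b k) in *. set (L := ln (/ delta k)) in *.
    apply Rabs_def2 in H3. destruct H3 as [H3 _].
    assert (H4 : L < (l + g / 2) * bk).
    { apply Rmult_lt_reg_r with (/ bk); [now apply Rinv_0_lt_compat|].
      rewrite Rmult_assoc, Rinv_r by lra. unfold Rdiv in H3. lra. }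
    assert (H5 : 1 < bk * (g / 2)).
    { apply Rmult_lt_compat_r with (r := g / 2) in H2; auto.
      replace (2 / g * (g / 2)) with 1 in H2 by (field; lra). lra. }
    assert (H6 : 1 < bk * (e / 2)).
    { apply Rmult_lt_compat_r with (r := e / 2) in H1; [|lra].
      replace (2 / e * (e / 2)) with 1 in H1 by (field; lra). lra. }
    assert (Hzb : 0 < z * bk) by (apply Rmult_lt_0_compat; auto; unfold z; lra).
    destruct (nat_between (z * bk)) as [N HN]; [lra|].
    assert (HN1 : (1 <= N)%nat) by (apply INR_lt; simpl; lra).
    assert (Hga : good_approx (2 * bk) (delta k) exp N).
    { apply (good_approx_exp_G bk (delta k) z N); auto; [unfold z; lra|lra|].
      fold L. pose proof ln_2_lt_1.
      replace (1 + G z) with (- l - g) by (unfold g; lra). lra. }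
    apply (proj2 Hmin), le_INR in Hga.
    apply Rmult_le_reg_r with bk; auto. unfold Rdiv.
    rewrite Rmult_assoc, Rinv_l, Rmult_1_r by lra.
    unfold z in *. lra.
  (* The maximum keeps [z] positive when [e] is large. *)
  - set (z := Rmax (z0 - e) (z0 / 2)).
    assert (Hz1 : 0 < z) by (unfold z; pose proof (Rmax_r (z0 - e) (z0 / 2)); lra).
    assert (Hz2 : z < z0) by (unfold z; apply Rmax_lub_lt; lra).
    assert (Hg : 0 < G z - G z0) by (pose proof (G_decreasing z z0 Hz1 Hz2); lra).
    set (g := G z - G z0) in *.
    assert (Hg2 : 0 < g / 2) by lra.
    pose proof (sqrt_sq_1_gt z Hz1) as Hs.
    (* Then [6 * ln (b / 2)] is at most [b * g / 8 - 6 * ln c], which leaves [3 * g / 8] of the half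
       gap to beat the constants. *)
    set (c := g / 24). assert (Hc : 0 < c) by (unfold c; lra).
    (* [K] is chosen so that [6 * ln (b / 2) + 14 <= (g / 2) * b] for [b > K] *)
    set (K := (14 - 6 * ln c) / (3 * g / 8)).
    set (q := sqrt (z ^ 2 + 1)) in *.
    generalize (filter_and _ _ (filter_and _ _ (Hbi K) (Hbi 2))
      (filter_and _ _ (Hbi (2 / (q - z))) (Hl (mkposreal _ Hg2)))).
    apply filter_imp. intros k [[H1 H2] [H3 H4]]. simpl in H4.
    specialize (Hb k). specialize (Hd k). specialize (Hmin k).
    set (bk := b k) in *.
    apply Rle_trans with z; [apply Rmax_l|].
    apply Rmult_le_reg_r with bk; auto. unfold Rdiv.
    rewrite Rmult_assoc, Rinv_l, Rmult_1_r by lra.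
    destruct (Rle_or_lt (z * bk) (INR (d k))) as [H|H]; auto. exfalso.
    assert (Hlow := good_approx_exp_lower_G bk (delta k) z (d k) Hb Hd Hz1
      ltac:(lra)). fold q in Hlow.
    assert (Hq : 2 <= (q - z) * bk).
    { apply Rmult_lt_compat_r with (r := q - z) in H3; [|lra].
      replace (2 / (q - z) * (q - z)) with 2 in H3 by (field; lra). lra. }
    specialize (Hlow Hq (proj1 Hmin) H).
    set (L := ln (/ delta k)) in *.
    apply Rabs_def2 in H4. destruct H4 as [_ H4].
    assert (H5 : (l - g / 2) * bk < L).
    { apply Rmult_lt_reg_r with (/ bk); [now apply Rinv_0_lt_compat|].
      rewrite Rmult_assoc, Rinv_r by lra. unfold Rdiv in H4. lra. }
    pose proof (ln_le_linear c (bk / 2) Hc ltac:(lra)) as Hln.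
    assert (H6 : 14 - 6 * ln c < bk * (3 * g / 8)).
    { apply Rmult_lt_compat_r with (r := 3 * g / 8) in H1; [|lra].
      unfold K in H1. replace ((14 - 6 * ln c) / (3 * g / 8) * (3 * g / 8))
        with (14 - 6 * ln c) in H1 by (field; lra). lra. }
    replace (1 + G z) with (- l + g) in Hlow by (unfold g; lra).
    replace (c * (bk / 2)) with (bk * g / 48) in Hln by (unfold c; field).
    lra.
Qed.

(** Here [B] may stay bounded. With [y = L / B], the choice [rho = e * y] costs a small multiple of
    [L] in the upper bound, and the term [i = 0] suffices below. *)
Lemma min_deg_exp_lim_small (B delta : nat -> R) (d : nat -> nat) :
  (forall k, 1 <= B k) -> (forall k, 0 < delta k < 1) ->
  (forall k, is_min_deg (B k) (delta k) exp (d k)) ->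
  is_lim_seq (fun k => ln (/ delta k) / B k) p_infty ->
  is_lim_seq (fun k => INR (d k) * ln (ln (/ delta k) / B k) / ln (/ delta k)) 1.
Proof.
  intros HB Hd Hmin Hy. apply is_lim_seq_spec in Hy. simpl in Hy.
  assert (Hln : forall M, eventually (fun k => M < ln (ln (/ delta k) / B k))).
  { intros M. generalize (Hy (exp M)). apply filter_imp. intros k Hk.
    rewrite <- (ln_exp M). apply ln_increasing; auto using exp_pos. }
  (* Rounding the degree costs one [ln y], negligible against [L] because [B >= 1] gives
     [y <= L]. *)
  assert (Hlin : forall e, 0 < e ->
    eventually (fun k => ln (ln (/ delta k) / B k) <= e * ln (/ delta k))).
  { intros e He.
    generalize (filter_and _ _ (Hy 0) (Hy (- ln (e / 2) / (e / 2)))).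
    apply filter_imp. intros k [H0 H1]. specialize (HB k).
    set (L := ln (/ delta k)) in *. set (y := L / B k) in *.
    pose proof (ln_le_linear (e / 2) y ltac:(lra) H0) as H2.
    apply Rmult_lt_compat_r with (r := e / 2) in H1; [|lra].
    replace (- ln (e / 2) / (e / 2) * (e / 2)) with (- ln (e / 2)) in H1 by (field; lra).
    assert (HL : L = B k * y) by (unfold y; field; lra).
    apply Rle_trans with (e * y); [lra|].
    apply Rmult_le_compat_l; [lra|]. rewrite HL. nra. }
  apply is_lim_seq_sandwich; intros e0 He0.
  - set (e := e0 / 2). assert (He : 0 < e) by (unfold e; lra).
    (* Chosen so that [(1 - h) * (1 + e) = 1 + e / 2]; eventually [ln (e * y) >= (1 - h) * ln y]. *)
    set (h := e / (2 * (1 + e))).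
    assert (Hh : 0 < h) by (unfold h; apply Rdiv_lt_0_compat; lra).
    generalize (filter_and _ _ (filter_and _ _ (Hy (8 / e)) (Hln 0))
      (filter_and _ _ (Hln (- ln e / h)) (Hlin e He))).
    apply filter_imp. intros k [[H1 H2] [H3 H4]].
    specialize (HB k). specialize (Hd k). specialize (Hmin k).
    set (L := ln (/ delta k)) in *. set (y := L / B k) in *.
    assert (HL : L = B k * y) by (unfold y; field; lra).
    assert (Hey : 8 < e * y).
    { apply Rmult_lt_compat_r with (r := e) in H1; auto.
      replace (8 / e * e) with 8 in H1 by (field; lra). lra. }
    assert (Hy0 : 0 < y) by nra.
    assert (HL0 : 0 < L) by (rewrite HL; apply Rmult_lt_0_compat; lra).
    set (X := (1 + e) * L / ln y).
    assert (HX : 0 < X).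
    { unfold X. apply Rdiv_lt_0_compat; auto. apply Rmult_lt_0_compat; lra. }
    destruct (nat_between X) as [N HN]; [lra|].
    assert (HN1 : (1 <= N)%nat) by (apply INR_lt; simpl; lra).
    assert (HXl : X * ln y = (1 + e) * L) by (unfold X; field; lra).
    assert (Hga : good_approx (B k) (delta k) exp N).
    { replace (B k) with (2 * (B k / 2)) by field.
      apply (good_approx_exp_log _ _ (e * y)); auto; try lra.
      fold L. rewrite ln_mult by auto.
      assert (Hle : - ln e < h * ln y).
      { apply Rmult_lt_compat_r with (r := h) in H3; auto.
        replace (- ln e / h * h) with (- ln e) in H3 by (field; lra). lra. }
      assert (H5 : (1 + e / 2) * L <= INR N * (ln e + ln y)).
      { apply Rle_trans with (X * ((1 - h) * ln y)).
        - right. replace (X * ((1 - h) * ln y)) with ((1 - h) * (X * ln y)) by ring.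
          rewrite HXl. unfold h. field. lra.
        - assert (h < 1).
          { unfold h. apply Rmult_lt_reg_r with (2 * (1 + e)); [lra|].
            unfold Rdiv. rewrite Rmult_assoc, Rinv_l; lra. }
          apply Rmult_le_compat; try lra. apply Rmult_le_pos; lra. }
      assert (Hinv : / (e * y) <= 1) by (rewrite <- Rinv_1; apply Rinv_le_contravar; lra).
      assert (H6 : B k / 2 * ((e * y + / (e * y)) / 2) <= e * L / 4 + B k / 4).
      { rewrite HL. nra. }
      (* Of the surplus [e * L / 2], half pays for the term in [rho]; the other half exceeds [2 * B]
         and covers [3 * B / 4 + ln 2]. *)
      assert (H7 : 8 * B k < e * L) by (rewrite HL; nra).
      pose proof ln_2_lt_1. lra. }
    apply (proj2 Hmin), le_INR in Hga.
    apply Rmult_le_reg_r with L; auto. unfold Rdiv.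
    rewrite Rmult_assoc, Rinv_l, Rmult_1_r by lra.
    apply Rle_trans with ((X + 1) * ln y).
    + apply Rmult_le_compat_r; lra.
    + unfold e in *. lra.
  - set (e := Rmin e0 (1 / 2)).
    assert (He : 0 < e) by (unfold e; apply Rmin_glb_lt; lra).
    assert (He1 : e <= 1 / 2) by apply Rmin_r.
    assert (Hee : e <= e0) by apply Rmin_l.
    generalize (filter_and _ _ (filter_and _ _ (Hy 8) (Hln 8)) (Hlin e He)).
    apply filter_imp. intros k [[H1 H2] H3].
    specialize (HB k). specialize (Hd k). specialize (Hmin k).
    set (L := ln (/ delta k)) in *. set (y := L / B k) in *.
    assert (HL : L = B k * y) by (unfold y; field; lra).
    assert (HL0 : 0 < L) by (rewrite HL; apply Rmult_lt_0_compat; lra).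
    apply Rle_trans with (1 - e); [lra|].
    apply Rmult_le_reg_r with L; auto. unfold Rdiv.
    rewrite Rmult_assoc, Rinv_l, Rmult_1_r by lra.
    destruct (Rle_or_lt ((1 - e) * L) (INR (d k) * ln y)) as [H|H]; auto. exfalso.
    set (X := (1 - e) * L / ln y).
    assert (HX : 0 < X).
    { unfold X. apply Rdiv_lt_0_compat; [|lra]. apply Rmult_lt_0_compat; lra. }
    assert (HXl : X * ln y = (1 - e) * L) by (unfold X; field; lra).
    destruct (nat_between X) as [N HN]; [lra|].
    assert (HdN : (d k < N)%nat).
    { apply INR_lt. apply Rlt_trans with X; [|lra].
      apply Rmult_lt_reg_r with (ln y); lra. }
    assert (Hlow := proj1 Hmin).
    replace (B k) with (2 * (B k / 2)) in Hlow by field.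
    apply (good_approx_exp_lower_log _ _ _ N 0) in Hlow; auto; try lra.
    fold L in Hlow. rewrite Nat.add_0_r in Hlow. simpl in Hlow.
    rewrite ln_1, Rplus_0_l in Hlow.
    pose proof (ln_fact_le_simple N ltac:(lia)) as Hf.
    assert (HN0 : 0 < INR N) by lra.
    (* This rests on [4 * N <= L]: [ln y > 8] gives [X <= L / 8], and rounding adds at most
       [1 <= B <= L / 8]. *)
    assert (H4 : INR N * ln (4 * INR N / B k) <= INR N * ln y).
    { apply Rmult_le_compat_l; [lra|]. apply ln_le.
      - apply Rdiv_lt_0_compat; lra.
      - apply Rmult_le_reg_r with (B k); [lra|]. unfold Rdiv.
        rewrite Rmult_assoc, Rinv_l, Rmult_1_r, (Rmult_comm y), <- HL by lra.
        assert (X * 8 <= X * ln y) by (apply Rmult_le_compat_l; lra).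
        assert (8 * B k <= L) by (rewrite HL; nra).
        nra. }
    assert (H5 : ln (4 * INR N / B k) = ln (INR N) - ln (B k / 2 / 2)).
    { rewrite <- ln_div by lra. f_equal. field. lra. }
    rewrite H5 in H4.
    assert (H6 : INR N * ln y <= (X + 1) * ln y) by (apply Rmult_le_compat_r; lra).
    lra.
Qed.

(** * The three regimes *)

(** Where [B k <= M], also [/ delta k <= exp (K * M)], so the sum stays below a fixed bound. *)
Lemma interval_unbounded (B delta : nat -> R) (K : R) :
  0 < K -> (forall k, 0 < delta k) ->
  eventually (fun k => ln (/ delta k) <= K * B k) ->
  is_lim_seq (fun k => B k + / delta k) p_infty ->
  is_lim_seq B p_infty.
Proof.
  intros HK Hd HL H. apply is_lim_seq_spec in H. simpl in H.
  apply is_lim_seq_spec. intros M.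
  generalize (filter_and _ _ HL (H (M + exp (K * M)))). apply filter_imp.
  intros k [H1 H2]. destruct (Rlt_or_le M (B k)) as [|HM]; auto. exfalso.
  assert (Hi : 0 < / delta k) by (apply Rinv_0_lt_compat, Hd).
  assert (/ delta k <= exp (K * M)).
  { apply Rnot_lt_le. intros Hlt. apply ln_increasing in Hlt; [|apply exp_pos].
    rewrite ln_exp in Hlt. apply Rmult_le_compat_l with (r := K) in HM; lra. }
  lra.
Qed.

Theorem theorem1p2 :
  forall (B delta : nat -> R) (d : nat -> nat),
    (forall k, 1 <= B k) ->
    (forall k, 0 < delta k < 1) ->
    is_lim_seq (fun k => B k + / delta k) p_infty ->
    (forall k, is_min_deg (B k) (delta k) exp (d k)) ->
    let L := fun k => ln (/ delta k) in
    (* (1) *)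
    (is_lim_seq (fun k => B k / L k) 0 ->
       is_lim_seq (fun k => INR (d k) / (L k / ln (/ B k * L k))) 1)
    /\
    (* (2) *)
    (forall r mu : R, 0 < r -> (forall k, B k = 2 * r * L k) ->
       0 < mu -> G mu = -1 - / r ->
       is_lim_seq (fun k => INR (d k) / L k) (mu * r))
    /\
    (* (3) *)
    (is_lim_seq (fun k => B k / L k) p_infty ->
       forall zs : R, 0 < zs -> G zs = -1 ->
       is_lim_seq (fun k => INR (d k) / (zs * B k / 2)) 1).
Proof.
  intros B delta d HB Hd Hinf Hmin L.
  assert (HL : forall k, 0 < L k).
  { intros k. unfold L. specialize (Hd k). rewrite ln_Rinv by lra.
    pose proof (ln_increasing (delta k) 1). rewrite ln_1 in *. lra. }
  assert (Hmin2 : forall k, is_min_deg (2 * (B k / 2)) (delta k) exp (d k)).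
  { intros k. replace (2 * (B k / 2)) with (B k) by field. apply Hmin. }
  assert (Hb : forall k, 0 < B k / 2) by (intros k; specialize (HB k); lra).
  assert (Hd0 : forall k, 0 < delta k) by (intros k; apply Hd).
  assert (Hhalf : is_lim_seq B p_infty -> is_lim_seq (fun k => B k / 2) p_infty).
  { intros H. apply is_lim_seq_spec in H. apply is_lim_seq_spec. intros M.
    generalize (H (2 * M)). apply filter_imp. intros k Hk. lra. }
  split; [|split].
  - intros H.
    assert (Hy : is_lim_seq (fun k => ln (/ delta k) / B k) p_infty).
    { apply is_lim_seq_ext with (fun k => / (B k / L k)).
      { intros k. specialize (HB k). specialize (HL k). unfold L in *. field. lra. }
      apply is_lim_seq_spec in H. apply is_lim_seq_spec. intros M.
      assert (HM : 0 < / (Rabs M + 1)).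
      { apply Rinv_0_lt_compat. pose proof (Rabs_pos M). lra. }
      generalize (H (mkposreal _ HM)). apply filter_imp. intros k Hk. simpl in Hk.
      assert (Hu : 0 < B k / L k) by (apply Rdiv_lt_0_compat; auto; specialize (HB k); lra).
      rewrite Rminus_0_r, Rabs_pos_eq in Hk by lra.
      apply Rinv_lt_contravar in Hk; [|now apply Rmult_lt_0_compat].
      rewrite Rinv_inv in Hk. pose proof (Rle_abs M). lra. }
    apply is_lim_seq_ext with
      (2 := min_deg_exp_lim_small B delta d HB Hd Hmin Hy).
    intros k. fold (L k). specialize (HB k). specialize (HL k).
    replace (L k / B k) with (/ B k * L k) by (field; lra).
    unfold Rdiv. rewrite Rinv_mult, Rinv_inv. ring.
  - intros r mu Hr HBr Hmu HG.
    assert (HBi : is_lim_seq B p_infty).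
    { apply (interval_unbounded B delta (/ r)); auto using Rinv_0_lt_compat.
      exists 0%nat. intros k _. fold (L k). rewrite HBr. specialize (HL k).
      replace (/ r * (2 * r * L k)) with (2 * L k) by (field; lra). lra. }
    assert (Hl : is_lim_seq (fun k => ln (/ delta k) / (B k / 2)) (/ r)).
    { apply is_lim_seq_ext with (fun _ => / r); [|apply is_lim_seq_const].
      intros k. fold (L k). rewrite HBr. specialize (HL k). field. lra. }
    pose proof (min_deg_exp_lim _ delta d mu (/ r) Hb Hd0 Hmin2 (Hhalf HBi) Hl Hmu HG) as H.
    (* Here [B / 2 = r * L], so rescaling by [r] turns the limit [mu] into [mu * r]. *)
    apply is_lim_seq_ext with (fun k => INR (d k) / (B k / 2) * r).
    { intros k. rewrite HBr. specialize (HL k). field. lra. }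
    apply (is_lim_seq_scal_r _ r mu) in H. exact H.
  - intros H zs Hz HG.
    assert (HBi : is_lim_seq B p_infty).
    { apply (interval_unbounded B delta 1); auto; [lra|].
      apply is_lim_seq_spec in H. generalize (H 1). apply filter_imp.
      intros k Hk. fold (L k). specialize (HL k).
      apply Rmult_lt_compat_r with (r := L k) in Hk; auto.
      unfold Rdiv in Hk. rewrite Rmult_assoc, Rinv_l in Hk; lra. }
    assert (Hl : is_lim_seq (fun k => ln (/ delta k) / (B k / 2)) 0).
    { apply is_lim_seq_ext with (fun k => 2 * / (B k / L k)).
      { intros k. fold (L k). specialize (HL k). specialize (HB k). field. lra. }
      replace (Finite 0) with (Rbar_mult 2 0) by (simpl; f_equal; ring).
      apply is_lim_seq_scal_l. apply (is_lim_seq_inv _ p_infty); auto. discriminate. }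
    assert (HG' : G zs = -1 - 0) by lra.
    pose proof (min_deg_exp_lim _ delta d zs 0 Hb Hd0 Hmin2 (Hhalf HBi) Hl Hz HG') as H2.
    apply is_lim_seq_ext with (fun k => INR (d k) / (B k / 2) * / zs).
    { intros k. specialize (HB k). field. lra. }
    apply (is_lim_seq_scal_r _ (/ zs) zs) in H2.
    replace (Finite 1) with (Rbar_mult zs (/ zs)); auto.
    simpl. f_equal. field. lra.
Qed.
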